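(* For $n\ge 1$ let $$E_n(x,y,z)=\sum_{\pi\in \mathcal{D}_n^B}x^{\mathrm{wexc}(\pi)}y^{\mathrm{aexc}(\pi)}z^{\mathrm{single}(\pi)}.$$ Define integers $g_n(i,j)$ ($n\ge1$, $i,j\in\mathbb{Z}$) by $g_1(1,0)=1$, $g_1(i,j)=0$ for $(i,j)\neq(1,0)$, and $$g_{n+1}(i,j)=g_n(i-1,j)+4(1+i)g_n(i+1,j-1)+2j\, g_n(i,j)+4(n+2-i-2j)g_n(i,j-1).$$ Then the $g_n(i,j)$ are nonnegative integers and, for $n\ge1$, $$E_n(x,y,z)=\sum_{i=0}^n z^{i}\sum_{j=0}^{\lfloor (n-i)/2\rfloor}g_n(i,j)(xy)^{j}(x+y)^{n-i-2j};$$ in particular $E_n(x,y,z)$ is a partial $\gamma$-positive polynomial (the coefficient of each $z^i$ is $\gamma$-positive).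
   Context: $B_n$ is the hyperoctahedral group: bijections $\pi$ of $\pm[n]=\{\pm1,\dots,\pm n\}$ with $\pi(-i)=-\pi(i)$. A fixed point of $\pi$ is $i\in[n]$ with $\pi(i)=i$; $\mathcal{D}_n^B$ is the set of $\pi\in B_n$ with no fixed points. For $\pi\in\mathcal D_n^B$: $\mathrm{wexc}(\pi)=\#\{i\in[n]:\pi(|\pi(i)|)>\pi(i)\}$, $\mathrm{aexc}(\pi)=\#\{i\in[n]:\pi(|\pi(i)|)<\pi(i)\}$, and $\mathrm{single}(\pi)=\#\{i\in[n]:\pi(i)=-i\}$. A symmetric polynomial $f(x)$ of degree $\le m$ is $\gamma$-positive if $f(x)=\sum_k \gamma_k x^k(1+x)^{m-2k}$ with all $\gamma_k\ge0$; a polynomial in $x,y,z$ expanded as $\sum_i z^i\sum_j c_{i,j}(xy)^j(x+y)^{m_i-2j}$ with $c_{i,j}\ge 0$ is called partial $\gamma$-positive. *)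

(* Defs.v *)
(* Mathematical Components, with multinomials for polynomials in x, y, z. *)
From mathcomp Require Import all_boot all_order all_algebra all_fingroup.
From mathcomp Require Import mpoly.

Set Implicit Arguments.
Unset Strict Implicit.
Unset Printing Implicit Defensive.

Import Order.TTheory GRing.Theory Num.Theory.
Local Open Scope ring_scope.

(* The set {±1, ..., ±n}: the pair (s, k) encodes k + 1 if s = false and
   -(k + 1) if s = true; spm_val_inj and spm_valP check the encoding. *)
Notation spm n := (bool * 'I_n)%type.

Definition spm_val n (a : spm n) : int :=
  if a.1 then - (a.2.+1)%:Z else (a.2.+1)%:Z.

Definition spm_pos n (k : 'I_n) : spm n := (false, k).
Definition spm_opp n (a : spm n) : spm n := (~~ a.1, a.2).
Definition spm_abs n (a : spm n) : spm n := (false, a.2).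

Lemma spm_val_opp n (a : spm n) : spm_val (spm_opp a) = - spm_val a.
Proof. by case: a => [[] k] //=; rewrite /spm_val /= opprK. Qed.

Lemma spm_val_abs n (a : spm n) : spm_val (spm_abs a) = `|spm_val a|.
Proof. by case: a => [[] k] //=; rewrite /spm_val /= normrN. Qed.

Lemma spm_val_inj n : injective (@spm_val n).
Proof.
move=> [[] k] [[] l]; rewrite /spm_val /=; 
  last by case=> e; congr pair; apply: val_inj.
- by move/oppr_inj; case=> e; congr pair; apply: val_inj.
- by move=> e; have := oppr_lt0 (k.+1)%:Z; rewrite e.
- by move=> e; have := oppr_lt0 (l.+1)%:Z; rewrite -e.
Qed.

Lemma spm_valP n (z : int) :
  reflect (exists a : spm n, spm_val a = z) (0 < `|z| <= n%:Z).
Proof.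
apply: (iffP idP) => [|[[[] k] <-]]; last 2 first.
- by rewrite /spm_val /= normrN; apply: ltn_ord.
- by rewrite /spm_val /=; apply: ltn_ord.
case: z => [[|k]|k] //= lekn.
  by exists (false, Ordinal (lekn : (k < n)%N)).
by exists (true, Ordinal (lekn : (k < n)%N)); rewrite /spm_val NegzE.
Qed.

Definition hyperoct n : {set {perm spm n}} :=
  [set p : {perm spm n} | [forall a, p (spm_opp a) == spm_opp (p a)]].

Definition fixpoint_free n (p : {perm spm n}) : bool :=
  [forall k : 'I_n, p (spm_pos k) != spm_pos k].

Definition derangeB n : {set {perm spm n}} :=
  [set p in hyperoct n | fixpoint_free p].

Definition wexc n (p : {perm spm n}) : nat :=
  #|[set k : 'I_n |
      spm_val (p (spm_pos k)) < spm_val (p (spm_abs (p (spm_pos k))))]|.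

Definition aexc n (p : {perm spm n}) : nat :=
  #|[set k : 'I_n |
      spm_val (p (spm_abs (p (spm_pos k)))) < spm_val (p (spm_pos k))]|.

Definition single n (p : {perm spm n}) : nat :=
  #|[set k : 'I_n | p (spm_pos k) == spm_opp (spm_pos k)]|.

Definition xvar : {mpoly int[3]} := 'X_(@Ordinal 3 0 isT).
Definition yvar : {mpoly int[3]} := 'X_(@Ordinal 3 1 isT).
Definition zvar : {mpoly int[3]} := 'X_(@Ordinal 3 2 isT).

Definition Epoly n : {mpoly int[3]} :=
  \sum_(p in derangeB n) xvar ^+ wexc p * yvar ^+ aexc p * zvar ^+ single p.

(* The recursion starts at n = 1; the value at n = 0 is a dummy. *)
Fixpoint gcoef (n : nat) (i j : int) {struct n} : int :=
  match n with
  | 0%N => 0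
  | m.+1 =>
    if m == 0%N then ((i == 1) && (j == 0))%:Z
    else gcoef m (i - 1) j
         + 4 * (1 + i) * gcoef m (i + 1) (j - 1)
         + 2 * j * gcoef m i j
         + 4 * (m%:Z + 2 - i - 2 * j) * gcoef m i (j - 1)
  end.

Lemma gcoef1 i j : gcoef 1 i j = if (i, j) == (1, 0) then 1 else 0.
Proof. by rewrite /= xpair_eqE; case: ifP. Qed.

Lemma gcoefS n i j : (0 < n)%N ->
  gcoef n.+1 i j =
    gcoef n (i - 1) j
    + 4 * (1 + i) * gcoef n (i + 1) (j - 1)
    + 2 * j * gcoef n i j
    + 4 * (n%:Z + 2 - i - 2 * j) * gcoef n i (j - 1).
Proof. by case: n. Qed.

(* The expansion forces f to be symmetric with respect to m, of degree <= m. *)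
Definition gamma_positive (m : nat) (f : {poly int}) : Prop :=
  exists c : nat -> int,
    (forall k, 0 <= c k) /\
    f = \sum_(0 <= k < (m./2).+1) c k *: ('X ^+ k * (1 + 'X) ^+ (m - 2 * k)).

Definition partial_gamma_positive (f : {mpoly int[3]}) : Prop :=
  exists (d : nat) (m : nat -> nat) (c : nat -> nat -> int),
    (forall i j, 0 <= c i j) /\
    f = \sum_(0 <= i < d.+1) zvar ^+ i *
          \sum_(0 <= j < ((m i)./2).+1)
             c i j *: ((xvar * yvar) ^+ j * (xvar + yvar) ^+ (m i - 2 * j)).

(* muni views f as a univariate polynomial in its last variable z. *)
Definition zcoef (i : nat) (f : {mpoly int[3]}) : {mpoly int[2]} := (muni f)`_i.

(* Substitution x := 'X, y := 1: gamma-positivity of a homogeneous polynomial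
   in x and y is that of the univariate polynomial it homogenizes. *)
Definition dehomog (f : {mpoly int[2]}) : {poly int} :=
  mmap (@polyC int) (fun k : 'I_2 => if k == ord0 then 'X else 1) f.

(* Main.v *)
(** Write [p(b, k) = (b xor e (s k), s k)] with [s] a permutation of
    [{1, ..., n}] and [e] a sign vector, and let [w k = ±k] with the sign [e k].
    Then [wexc] and [aexc] count the ascents and descents of [w] along the
    arcs [k -> s k], so that [E_n] is a sum, over signs, of permanents. Let [F_n]
    be the same sum with weight [x] for an ascent, [y] for a descent, [z] for a
    negative fixed point and [t] for a positive one. The value [±(n+1)], larger or
    smaller than all others, is either a new fixed point or is inserted into an arc,
    whose weight is then replaced by [x y]. Hence [F_(n+1) = (z + t) F_n + D F_n],
    where [D] is the derivation sending each of the four variables to [2 x y]. With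
    [q = z + t], [u = x y], [v = x + y] we have [D q = D v = 4 u], [D u = 2 u v],
    and comparing coefficients of [q^i u^j v^(n-i-2j)] gives the recursion of
    [g_n(i, j)]. Putting [t = 0] yields [E_n]. *)
From HB Require Import structures.
Require Import Defs.
From mathcomp Require Import all_boot all_order all_algebra all_fingroup.
From mathcomp Require Import mpoly.
From mathcomp Require Import zify ring.

Set Implicit Arguments.
Unset Strict Implicit.
Unset Printing Implicit Defensive.

Import Order.TTheory GRing.Theory Num.Theory.
Local Open Scope ring_scope.

(** * Support and sign of the numbers [gcoef n i j] *)

(** The recursion never leaves the triangle: a neighbour inside it can only enter with factor
    [1 + i] at [i = -1] or [n + 2 - i - 2 * j] at [i + 2 * j = n + 2], both zero. *)
Lemma gcoef_outside n i j : (i < 0) || (j < 0) || (n%:Z < i + 2 * j) ->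
  gcoef n i j = 0.
Proof.
elim: n i j => [//|n IHn] i j.
have [->|n_gt0] := posnP n; first by rewrite /= => H; lia.
move=> H; rewrite gcoefS // (IHn (i - 1)); last by lia.
have -> : 2 * j * gcoef n i j = 0 by rewrite IHn ?mulr0 //; lia.
have -> : 4 * (1 + i) * gcoef n (i + 1) (j - 1) = 0.
  have [->|ni] := eqVneq i (- 1); first by rewrite subrr mulr0 mul0r.
  by rewrite IHn ?mulr0 //; lia.
have [e|ne] := eqVneq (i + 2 * j) (n%:Z + 2); last first.
  by rewrite IHn ?mulr0 //; lia.
have -> : n%:Z + 2 - i - 2 * j = 0 by lia.
by rewrite mulr0 mul0r.
Qed.

(** The factors of the recursion are nonnegative inside the triangle, and outside it the value is
    zero. *)
Lemma gcoef_ge0 n i j : 0 <= gcoef n i j.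
Proof.
elim: n i j => [//|n IHn] i j.
have [->|n_gt0] := posnP n; first by rewrite /=; case: andP.
have [out|/norP[/norP[i0 j0] ij]] :=
  boolP ((i < 0) || (j < 0) || (n.+1%:Z < i + 2 * j)).
  by rewrite gcoef_outside.
rewrite gcoefS //; do !apply: addr_ge0 => //.
- by apply: mulr_ge0 => //; lia.
- by apply: mulr_ge0 => //; lia.
- by apply: mulr_ge0 => //; lia.
Qed.

(** * Leibniz rules for a derivation of a commutative ring *)

Section Derivation.
Variables (R : comNzRingType) (D : {additive R -> R}).
Hypothesis DM : forall a b, D (a * b) = D a * b + a * D b.

Lemma derivation1 : D 1 = 0.
Proof.
by apply: (@addIr _ (D 1)); rewrite add0r -{3}[1]mulr1 DM mulr1 mul1r.
Qed.

Lemma derivationX a k : D (a ^+ k) = a ^+ k.-1 * D a *+ k.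
Proof.
elim: k => [|[|k] IHk]; first by rewrite expr0 derivation1.
  by rewrite mulr1n mul1r.
by rewrite exprS DM IHk /= exprS [in RHS]mulrS mulrnAr mulrC mulrA.
Qed.

Lemma derivation_prod (I : finType) (f : I -> R) :
  D (\prod_k f k) = \sum_k D (f k) * \prod_(l | l != k) f l.
Proof.
elim: (index_enum I) (index_enum_uniq I) => [|a s IHs] /=.
  by rewrite !big_nil derivation1.
case/andP=> as_ us; rewrite !big_cons DM IHs // eqxx /=; congr (_ * _ + _).
  rewrite big_seq [RHS]big_seq_cond; apply: eq_bigl => l.
  by case: eqVneq => [->|]; rewrite ?(negbTE as_) ?andbT.
rewrite mulr_sumr !big_seq; apply: eq_bigr => k ks.
rewrite big_cons; have [ak|_] := eqVneq a k; first by rewrite ak ks in as_.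
by rewrite mulrCA.
Qed.
End Derivation.

(** * Permanents and the insertion of a largest index *)

(** [p.1] is recovered as the preimage of [ord_max], and cancelling the transposition then recovers
    [p.2]; the cardinalities agree by [(n+1)! = (n+1) * n!]. *)
Lemma perm_insert_bij n :
  bijective (fun p : 'I_n.+1 * 'S_n =>
               (tperm ord_max p.1 * lift_perm ord_max ord_max p.2)%g).
Proof.
apply: inj_card_bij; last first.
  by rewrite card_prod !card_Sn card_ord factS.
move=> [a s] [b t] /= e; have eab : a = b.
  apply: (@perm_inj _ (tperm ord_max b * lift_perm ord_max ord_max t)%g).
  by rewrite -{1}e !permM !tpermR !lift_perm_id.
rewrite -eab in e *; congr pair; apply/permP=> k.
apply: (@lift_inj _ ord_max).
by rewrite -!(lift_perm_lift ord_max) (mulgI _ _ _ e).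
Qed.

(* Deleting the largest index from its cycle: either it is a fixed point, or
   the arcs k -> max -> l contract to k -> l. *)
Lemma permanent_insert (R : comNzRingType) n (A : 'I_n.+1 -> 'I_n.+1 -> R) c
    (B := fun k l => A (lift ord_max k) (lift ord_max l)) :
    (forall k l : 'I_n, A (lift ord_max k) ord_max * A ord_max (lift ord_max l) = c) ->
  \sum_(s : 'S_n.+1) \prod_k A k (s k) =
    A ord_max ord_max * \sum_(s : 'S_n) \prod_k B k (s k) +
    c * \sum_(s : 'S_n) \sum_k \prod_(l | l != k) B l (s l).
Proof.
move=> Ac; rewrite (reindex _ (onW_bij _ (perm_insert_bij n))) /=.
rewrite -(pair_bigA _ (fun a s => \prod_k
  A k ((tperm ord_max a * lift_perm ord_max ord_max s)%g k))) /=.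
have prod_rec (f : 'I_n.+1 -> R) :
    \prod_k f k = f ord_max * \prod_(k < n) f (lift ord_max k).
  rewrite big_ord_recr /= mulrC /=; congr (_ * _); apply: eq_bigr => k _.
  by congr f; apply: ord_inj; rewrite lift_max.
rewrite big_ord_recr /= addrC /=; congr (_ + _).
  rewrite mulr_sumr; apply: eq_bigr => s _; rewrite prod_rec.
  rewrite permM tpermR lift_perm_id; congr (_ * _); apply: eq_bigr => k _.
  by rewrite permM tperm1 perm1 lift_perm_lift.
rewrite exchange_big mulr_sumr; apply: eq_bigr => s _.
rewrite mulr_sumr; apply: eq_bigr => k _; rewrite prod_rec.
have -> : widen_ord (leqnSn n) k = lift ord_max k.
  by apply: ord_inj; rewrite lift_max.
rewrite permM tpermL lift_perm_lift (bigD1 k) //= permM tpermR lift_perm_id.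
rewrite mulrCA mulrA Ac; congr (_ * _); apply: eq_bigr => l lk.
by rewrite permM tpermD ?lift_perm_lift ?neq_lift // (inj_eq lift_inj) eq_sym.
Qed.

(** * Signed permanents and their recursion in [n] *)

(** [a] and [b] will be the signed values at the ends of an arc. They agree only on a loop, so [z]
    and [t] mark negative and positive fixed points. *)
Definition arc_weight (R : comNzRingType) (x y z t : R) (a b : int) : R :=
  if a < b then x else if b < a then y else if a < 0 then z else t.

Definition sign_val n (e : {ffun 'I_n -> bool}) (k : 'I_n) : int :=
  spm_val (e k, k).

Definition signed_permanent (R : comNzRingType) (m : int -> int -> R) n : R :=
  \sum_(e : {ffun 'I_n -> bool}) \sum_(s : 'S_n)
     \prod_k m (sign_val e k) (sign_val e (s k)).

Definition ffun_rcons n (p : bool * {ffun 'I_n -> bool}) :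
    {ffun 'I_n.+1 -> bool} :=
  [ffun k => if unlift ord_max k is Some l then p.2 l else p.1].

Lemma ffun_rcons_bij n : bijective (@ffun_rcons n).
Proof.
exists (fun e : {ffun 'I_n.+1 -> bool} =>
  (e ord_max, [ffun k : 'I_n => e (lift ord_max k)])) => [[b e]|e].
  rewrite /ffun_rcons ffunE unlift_none /=; congr pair.
  by apply/ffunP=> k; rewrite !ffunE liftK.
apply/ffunP=> k; rewrite ffunE /=.
by case: unliftP => [l|] -> //; rewrite ffunE.
Qed.

Lemma sign_val_rcons_lift n b (e : {ffun 'I_n -> bool}) k :
  sign_val (ffun_rcons (b, e)) (lift ord_max k) = sign_val e k.
Proof. by rewrite /sign_val ffunE liftK /spm_val lift_max. Qed.

Lemma sign_val_rcons_max n b (e : {ffun 'I_n -> bool}) :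
  sign_val (ffun_rcons (b, e)) ord_max = (-1) ^+ b * n.+1%:Z.
Proof.
by rewrite /sign_val ffunE unlift_none /spm_val /=; case: b; rewrite ?mulN1r ?mul1r.
Qed.

Lemma sign_val_bound n (e : {ffun 'I_n -> bool}) k :
  - n.+1%:Z < sign_val e k < n.+1%:Z.
Proof. by rewrite /sign_val /spm_val /=; have := ltn_ord k; case: (e k); lia. Qed.

Lemma signed_permanentS (R : comNzRingType) (D : {additive R -> R})
    (x y z t : R) n (F := signed_permanent (arc_weight x y z t)) :
    (forall a b, D (a * b) = D a * b + a * D b) ->
    {in [:: x; y; z; t], forall v, D v = 2 * (x * y)} ->
  F n.+1 = (z + t) * F n + D (F n).
Proof.
move=> DM Dv; set m := arc_weight x y z t.
have Dm a b : D (m a b) = 2 * (x * y).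
  by apply: Dv; rewrite /m /arc_weight; do 3?case: ifP; rewrite !inE eqxx ?orbT.
rewrite {1}/F /signed_permanent (reindex _ (onW_bij _ (ffun_rcons_bij n))) /=.
rewrite -(pair_bigA _ (fun b e => \sum_(s : 'S_n.+1) \prod_k
  m (sign_val (ffun_rcons (b, e)) k) (sign_val (ffun_rcons (b, e)) (s k)))) /=.
(* The new value is the largest or the smallest according to [b], so of the two arcs at [ord_max]
   one ascends and one descends: their product is [x * y] in either case. *)
have step b e : \sum_(s : 'S_n.+1) \prod_k
    m (sign_val (ffun_rcons (b, e)) k) (sign_val (ffun_rcons (b, e)) (s k)) =
  (if b then z else t) * \sum_(s : 'S_n) \prod_k m (sign_val e k) (sign_val e (s k))
  + (x * y) * \sum_(s : 'S_n) \sum_k \prod_(l | l != k)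
      m (sign_val e l) (sign_val e (s l)).
  pose A k l := m (sign_val (ffun_rcons (b, e)) k) (sign_val (ffun_rcons (b, e)) l).
  rewrite (@permanent_insert _ _ A (x * y)) => [|k l].
    congr (_ * _ + _ * _).
    + rewrite /A sign_val_rcons_max /m /arc_weight ltxx.
      by case: (b); rewrite ?mulN1r ?mul1r.
    + apply: eq_bigr => s _; apply: eq_bigr => k _.
      by rewrite /A !sign_val_rcons_lift.
    + apply: eq_bigr => s _; apply: eq_bigr => k _; apply: eq_bigr => l _.
      by rewrite /A !sign_val_rcons_lift.
  rewrite /A !sign_val_rcons_lift sign_val_rcons_max /m /arc_weight.
  have /andP[k1 k2] := sign_val_bound e k.
  have /andP[l1 l2] := sign_val_bound e l.
  case: (b); rewrite ?mulN1r ?mul1r.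
    by rewrite ltNge (ltW k1) k1 l1 mulrC.
  by rewrite k2 [_ < sign_val e l]ltNge (ltW l2) l2.
under eq_bigr => b _ do under eq_bigr => e _ do rewrite step.
rewrite big_bool /= !big_split /= -!mulr_sumr -/(signed_permanent m n).
rewrite mulrDl -/F.
(* By Leibniz, [D] replaces one arc weight at a time by [2 * (x * y)]; the factor 2 accounts for the
   two signs [b]. *)
have -> : D (F n) = 2 * (x * y * \sum_(e : {ffun 'I_n -> bool}) \sum_(s : 'S_n)
    \sum_k \prod_(l | l != k) m (sign_val e l) (sign_val e (s l))).
  rewrite /F /signed_permanent raddf_sum /= !mulr_sumr; apply: eq_bigr => e _.
  rewrite raddf_sum /= !mulr_sumr; apply: eq_bigr => s _.
  rewrite (derivation_prod DM) !mulr_sumr; apply: eq_bigr => k _.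
  by rewrite Dm -mulrA.
by rewrite mulr2n mulrDl mul1r addrACA.
Qed.

(** * The gamma expansion obeys the same recursion *)

Lemma sum_shift (V : nmodType) N (f : nat -> V) : f 0%N = 0 -> f N = 0 ->
  \sum_(0 <= i < N) f i = \sum_(0 <= i < N) f i.+1.
Proof.
move=> f0 fN; apply: etrans (_ : \sum_(0 <= i < N.+1) f i = _).
  by rewrite big_nat_recr //= fN addr0.
by rewrite big_nat_recl //= f0 add0r.
Qed.

(* Any [N > n] gives the same value, since [gcoef n i j = 0] outside
   [0 <= i, 0 <= j, i + 2 * j <= n]. *)
Definition gamma_sum (R : comNzRingType) N n (s u v : R) : R :=
  \sum_(0 <= i < N) \sum_(0 <= j < N)
     (gcoef n i%:Z j%:Z)%:~R * (s ^+ i * u ^+ j * v ^+ (n - i - 2 * j)).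

(** [D] sends [s^i u^j v^k] to [4i s^(i-1) u^(j+1) v^k + 2j s^i u^j v^(k+1) + 4k s^i u^(j+1)
    v^(k-1)]; with the product by [s] these are the four terms of the recursion. The bound
    [n.+1 < N] leaves room for the index shifts. *)
Lemma gamma_sumS (R : comNzRingType) (D : {additive R -> R}) N n (s u v : R) :
    (forall a b, D (a * b) = D a * b + a * D b) ->
    D s = 4 * u -> D u = 2 * u * v -> D v = 4 * u ->
    (0 < n)%N -> (n.+1 < N)%N ->
  gamma_sum N n.+1 s u v = s * gamma_sum N n s u v + D (gamma_sum N n s u v).
Proof.
move=> DM Ds Du Dv n_gt0 nN.
have g0 i j : (n < i + 2 * j)%N -> gcoef n i%:Z j%:Z = 0.
  by move=> ij; apply: gcoef_outside; lia.
pose g i j : R := (gcoef n i j)%:~R.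
pose w i j := s ^+ i * u ^+ j * v ^+ (n.+1 - i - 2 * j).
pose f1 (i j : nat) := g (i%:Z - 1) j%:Z * w i j.
pose f2 (i j : nat) := 4 * i.+1%:R * g (i.+1)%:Z (j%:Z - 1) * w i j.
pose f3 (i j : nat) := 2 * j%:R * g i%:Z j%:Z * w i j.
pose f4 (i j : nat) :=
  4 * (n%:Z + 2 - i%:Z - 2 * j%:Z)%:~R * g i%:Z (j%:Z - 1) * w i j.
pose h2 (i j : nat) :=
  g i%:Z j%:Z * (i%:R * s ^+ i.-1 * (4 * u) * u ^+ j * v ^+ (n - i - 2 * j)).
have -> : gamma_sum N n.+1 s u v =
    \sum_(0 <= i < N) \sum_(0 <= j < N) (f1 i j + f2 i j + f3 i j + f4 i j).
  apply: eq_bigr => i _; apply: eq_bigr => j _.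
  rewrite gcoefS // /f1 /f2 /f3 /f4 /g /w.
  have -> : i%:Z + 1 = i.+1%:Z by lia.
  by ring.
(* After the shifts below, [f1] comes from [s * _], [f2], [f3], [f4] from the
   derivatives of [s ^+ i], [u ^+ j] and [v ^+ (n - i - 2 * j)]. *)
have E1 : \sum_(0 <= i < N) \sum_(0 <= j < N) f1 i j =
    \sum_(0 <= i < N) \sum_(0 <= j < N) f1 i.+1 j.
  rewrite (@sum_shift _ N (fun i => \sum_(0 <= j < N) f1 i j)) //.
    by rewrite big1 // => j _; rewrite /f1 /g gcoef_outside ?mul0r.
  by rewrite big1 // => j _; rewrite /f1 /g gcoef_outside ?mul0r //; lia.
have E2 : \sum_(0 <= i < N) \sum_(0 <= j < N) f2 i j =
    \sum_(0 <= i < N) \sum_(0 <= j < N) h2 i j.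
  (* [D s = 4 * u] trades an [s] for a [u], so [f2 i j.+1] has to match [h2 i.+1 j]. *)
  rewrite (@sum_shift _ N (fun i => \sum_(0 <= j < N) h2 i j)); last 2 first.
  - by rewrite big1 // => j _; rewrite /h2 !mul0r mulr0.
  - by rewrite big1 // => j _; rewrite /h2 /g gcoef_outside ?mul0r //; lia.
  apply: eq_bigr => i _; rewrite sum_shift; first last.
  - by rewrite /f2 /g gcoef_outside ?mulr0 ?mul0r //; lia.
  - by rewrite /f2 /g gcoef_outside ?mulr0 ?mul0r //; lia.
  apply: eq_bigr => j _; rewrite /f2 /h2 /w.
  have -> : (j.+1)%:Z - 1 = j%:Z by lia.
  have -> : (n.+1 - i - 2 * j.+1 = n - i.+1 - 2 * j)%N by lia.
  by rewrite exprS /=; ring.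
have E4 : \sum_(0 <= i < N) \sum_(0 <= j < N) f4 i j =
    \sum_(0 <= i < N) \sum_(0 <= j < N) f4 i j.+1.
  apply: eq_bigr => i _; rewrite sum_shift //.
  - by rewrite /f4 /g gcoef_outside ?mulr0 ?mul0r //; lia.
  - by rewrite /f4 /g gcoef_outside ?mulr0 ?mul0r //; lia.
have split_sum (a b : nat -> nat -> R) :
    \sum_(0 <= i < N) \sum_(0 <= j < N) (a i j + b i j) =
    \sum_(0 <= i < N) \sum_(0 <= j < N) a i j +
    \sum_(0 <= i < N) \sum_(0 <= j < N) b i j.
  by rewrite -big_split; apply: eq_bigr => i _; rewrite big_split.
rewrite !split_sum E1 E2 E4 -!split_sum /gamma_sum raddf_sum mulr_sumr -big_split.
apply: eq_bigr => i _; rewrite raddf_sum mulr_sumr -big_split.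
apply: eq_bigr => j _ /=.
rewrite mulrzl raddfMz -mulrzl !DM !(derivationX DM) Ds Du Dv.
rewrite -/(g i%:Z j%:Z) /f1 /f2 /f3 /f4 /h2 /w.
have -> : (j.+1)%:Z - 1 = j%:Z by lia.
have -> : (i.+1)%:Z - 1 = i%:Z by lia.
(* Where the truncated exponent [n - i - 2 * j] is meaningless, the coefficient vanishes. *)
have [out|] := ltnP n (i + 2 * j); first by rewrite /g g0 //; ring.
move=> ij; have [k nE] : exists k, n = (i + 2 * j + k)%N.
  by exists (n - (i + 2 * j))%N; lia.
rewrite subSS.
have -> : (n.+1 - i - 2 * j = k.+1)%N by lia.
have -> : (n - i - 2 * j = k)%N by lia.
(* At [k = 0] the exponent [k.-1] is harmless, since the factor [k] kills the term. *)
have -> : (n.+1 - i - 2 * j.+1 = k.-1)%N by lia.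
have -> : n%:Z + 2 - i%:Z - 2 * (j.+1)%:Z = k%:Z by lia.
rewrite !exprS.
have uE : u * (u ^+ j.-1 * j%:R) = u ^+ j * j%:R.
  by case: (j) => [|l]; rewrite ?mulr0 // mulrA -exprS.
transitivity (g i%:Z j%:Z * (s * s ^+ i * u ^+ j * v ^+ k
   + i%:R * s ^+ i.-1 * (4 * u) * u ^+ j * v ^+ k
   + 2 * v * s ^+ i * (u ^+ j * j%:R) * v ^+ k
   + 4 * k%:R * s ^+ i * u * u ^+ j * v ^+ k.-1)).
  by rewrite pmulrn; ring.
by rewrite -uE; ring.
Qed.

Lemma gamma_sum_rmorph (R S : comNzRingType) (phi : {rmorphism R -> S}) N n s u v :
  phi (gamma_sum N n s u v) = gamma_sum N n (phi s) (phi u) (phi v).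
Proof.
rewrite rmorph_sum; apply: eq_bigr => i _; rewrite rmorph_sum.
by apply: eq_bigr => j _; rewrite !rmorphM rmorph_int !rmorphXn.
Qed.

Lemma gamma_sum_rows (R : comNzRingType) n (s u v : R) :
  gamma_sum n.+1 n s u v =
    \sum_(0 <= i < n.+1) s ^+ i * \sum_(0 <= j < ((n - i)./2).+1)
       (gcoef n i%:Z j%:Z)%:~R * (u ^+ j * v ^+ (n - i - 2 * j)).
Proof.
apply: eq_big_nat => i /andP[_ iN].
rewrite (big_cat_nat (n := ((n - i)./2).+1)) //=; last by lia.
rewrite [X in _ + X]big_nat_cond [X in _ + X]big1 ?addr0 => [|j].
  by rewrite mulr_sumr; apply: eq_bigr => j _; ring.
by rewrite andbT => ij; rewrite gcoef_outside ?mul0r //; lia.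
Qed.

Lemma signed_permanent0 (R : comNzRingType) (m : int -> int -> R) :
  signed_permanent m 0 = 1.
Proof.
rewrite /signed_permanent (big_pred1 [ffun=> false]) => [|e].
  by rewrite (big_pred1 1%g) => [|s]; [rewrite big_ord0 | apply/esym/eqP/permP; case].
by apply/esym/eqP/ffunP; case.
Qed.

Lemma signed_permanent_gamma (R : comNzRingType) (D : {additive R -> R})
    (x y z t : R) N n :
    (forall a b, D (a * b) = D a * b + a * D b) ->
    {in [:: x; y; z; t], forall v, D v = 2 * (x * y)} ->
    (0 < n)%N -> (n < N)%N ->
  signed_permanent (arc_weight x y z t) n = gamma_sum N n (z + t) (x * y) (x + y).
Proof.
move=> DM Dv; have [Dx Dy Dz Dt] : [/\ D x = 2 * (x * y), D y = 2 * (x * y),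
    D z = 2 * (x * y) & D t = 2 * (x * y)].
  by split; apply: Dv; rewrite !inE eqxx ?orbT.
elim: n => [//|n IHn] _ nN; rewrite (signed_permanentS _ DM Dv).
(* The numbers [gcoef] start at 1, so that case is computed directly: [F_0 = 1] and [D 1 = 0] give
   [F_1 = z + t]. *)
have [n0|n_gt0] := posnP n; last first.
  rewrite (IHn n_gt0 (ltnW nN)) (gamma_sumS DM) //.
  - by rewrite raddfD /= Dz Dt; ring.
  - by rewrite DM Dx Dy; ring.
  - by rewrite raddfD /= Dx Dy; ring.
rewrite n0 in nN *; rewrite signed_permanent0 (derivation1 DM) addr0 mulr1.
rewrite /gamma_sum (bigD1_seq 1%N) ?mem_index_iota ?iota_uniq //=.
rewrite [X in _ = _ + X]big1 ?addr0 => [|i i1]; last first.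
  by apply: big1 => j _; rewrite eqz_nat (negbTE i1) mul0r.
rewrite (bigD1_seq 0%N) ?mem_index_iota ?iota_uniq //=; last by lia.
rewrite [X in _ = _ + X]big1 ?addr0 => [|j j1]; last by rewrite eqz_nat (negbTE j1) mul0r.
by rewrite !mul1r !mulr1.
Qed.

(** * The derivation on polynomials in [x, y, z, t] *)

Local Notation X4 k := ('X_(@Ordinal 4 k isT) : {mpoly int[4]}).

(** The variable [t] must stay free here: [D t = 2xy] is nonzero, so [t = 0] can be substituted only
    after the recursion is solved. *)
Definition xy_derivation (p : {mpoly int[4]}) : {mpoly int[4]} :=
  2 * (X4 0 * X4 1) * \sum_i mderiv i p.

Lemma xy_derivation_is_additive : additive xy_derivation.
Proof.
move=> p q; rewrite /xy_derivation -mulrBr -sumrB.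
by congr (_ * _); apply: eq_bigr => i _; rewrite mderivB.
Qed.

HB.instance Definition _ := GRing.isAdditive.Build {mpoly int[4]} {mpoly int[4]}
  xy_derivation xy_derivation_is_additive.

Lemma xy_derivationM p q :
  xy_derivation (p * q) = xy_derivation p * q + p * xy_derivation q.
Proof.
rewrite /xy_derivation; under eq_bigr do rewrite mderivM.
by rewrite big_split /= -mulr_suml -mulr_sumr; ring.
Qed.

Lemma xy_derivationU i : xy_derivation 'X_i = 2 * (X4 0 * X4 1).
Proof.
rewrite /xy_derivation (bigD1 i) //= big1 => [|k ki].
  by rewrite mderivX mnm1E eqxx scale1r -{1}[U_(i)%MM]add0m addmK mpolyX0 addr0 mulr1.
by rewrite mderivX mnm1E eq_sym (negbTE ki) scale0r.
Qed.

(** * Signed permutations as sign vectors with permutations *)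

(** The sign is indexed by the image [s k], which makes [p(k)] and [p(|p(k)|)] the signed values at
    the ends of the arc from [s k] to [s (s k)]. *)
Definition signed_perm_fun n (e : {ffun 'I_n -> bool}) (s : 'S_n) (a : spm n) :
  spm n := (a.1 (+) e (s a.2), s a.2).

Lemma signed_perm_inj n (e : {ffun 'I_n -> bool}) (s : 'S_n) :
  injective (signed_perm_fun e s).
Proof. by move=> [b k] [c l] [/[swap] /perm_inj -> /addIb ->]. Qed.

Definition signed_perm n (p : {ffun 'I_n -> bool} * 'S_n) : {perm spm n} :=
  perm (@signed_perm_inj n p.1 p.2).

Lemma signed_permE n p b (k : 'I_n) :
  signed_perm p (b, k) = (b (+) p.1 (p.2 k), p.2 k).
Proof. by rewrite permE. Qed.

Lemma signed_perm_injective n : injective (@signed_perm n).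
Proof.
move=> [e s] [f t] /permP est.
have st : s = t.
  by apply/permP=> k; have := est (false, k); rewrite !signed_permE => -[].
rewrite -st in est *; congr pair; apply/ffunP=> k.
by have := est (false, s^-1%g k); rewrite !signed_permE /= permKV => -[].
Qed.

Lemma hyperoct_signed_perm n : hyperoct n = @signed_perm n @: setT.
Proof.
apply/setP=> p; apply/idP/imsetP => [|[[e s] _ ->]]; last first.
  rewrite inE; apply/forallP=> -[b k].
  by rewrite !signed_permE /spm_opp /= addNb.
rewrite inE => /forallP pN.
have pE b k : p (b, k) = (b (+) (p (false, k)).1, (p (false, k)).2).
  case: b; last by rewrite addFb; case: (p _).
  by have /eqP := pN (false, k).
have s_inj : injective (fun k => (p (false, k)).2).
  move=> k l /= kl.
  (* Giving each argument the sign of its own image makes both images positive. *)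
  have : p ((p (false, k)).1, k) = p ((p (false, l)).1, l).
    by rewrite pE [RHS]pE !addbb kl.
  by move/perm_inj=> -[].
pose s := perm s_inj.
exists ([ffun k => (p (false, s^-1%g k)).1], s) => //.
apply/permP=> -[b k]; rewrite signed_permE /= ffunE permK permE.
exact: pE.
Qed.

Lemma prod_if_card (R : comNzRingType) (I : finType) (P : pred I) (a : R) :
  \prod_i (if P i then a else 1) = a ^+ #|[set i | P i]|.
Proof. by rewrite -big_mkcond /= prodr_const cardsE. Qed.

(** A positive fixed point contributes a factor [t = 0]. Equality of [p(k)] and [p(|p(k)|)] forces
    [|p(k)| = k], hence [p(k) = -k] without fixed points. *)
Lemma derangeB_weight n (p : {perm spm n}) (x y z : {mpoly int[3]}) :
  \prod_k arc_weight x y z 0 (spm_val (p (spm_pos k)))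
                             (spm_val (p (spm_abs (p (spm_pos k))))) =
  if fixpoint_free p then x ^+ wexc p * y ^+ aexc p * z ^+ single p else 0.
Proof.
case: ifPn => [/forallP pf|]; last first.
  rewrite negb_forall => /existsP[k]; rewrite negbK => /eqP pk.
  by rewrite (bigD1 k) //= /arc_weight pk -[spm_abs _]/(spm_pos k) pk ltxx mul0r.
rewrite /wexc /aexc /single -!prod_if_card -!big_split /=.
apply: eq_bigr => k _; rewrite /arc_weight.
case: ltgtP => [lt_ab|lt_ba|/spm_val_inj/perm_inj pk].
- rewrite !mulr1; case: eqP => [pk|]; last by rewrite mulr1.
  by rewrite pk -[spm_abs _]/(spm_pos k) pk ltxx in lt_ab.
- rewrite mul1r; case: eqP => [pk|]; last by rewrite mulr1.
  by rewrite pk -[spm_abs _]/(spm_pos k) pk ltxx in lt_ba.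
have -> : p (spm_pos k) = spm_opp (spm_pos k).
  have := pf k; case: (p (spm_pos k)) pk => [[] l] [->] //.
  by rewrite eqxx.
by rewrite eqxx !mul1r.
Qed.

Lemma Epoly_signed_permanent n :
  Epoly n = signed_permanent (arc_weight xvar yvar zvar 0) n.
Proof.
rewrite /Epoly /derangeB; under eq_bigl do rewrite inE.
rewrite big_mkcondr /=; under eq_bigr do rewrite -derangeB_weight.
rewrite hyperoct_signed_perm big_imset /=; last by move=> ? ? _ _ /signed_perm_injective.
under eq_bigl do rewrite inE.
rewrite /signed_permanent pair_bigA; apply: eq_bigr => -[e s] _.
(* Index each arc by the predecessor [k] of its source [s k]. *)
rewrite [RHS](reindex_inj (@perm_inj _ s)); apply: eq_bigr => k _.
by rewrite /spm_pos signed_permE /spm_abs /= signed_permE.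
Qed.

Lemma signed_permanent_rmorph (R S : comNzRingType) (phi : {rmorphism R -> S})
    x y z t n :
  phi (signed_permanent (arc_weight x y z t) n) =
  signed_permanent (arc_weight (phi x) (phi y) (phi z) (phi t)) n.
Proof.
rewrite rmorph_sum; apply: eq_bigr => e _; rewrite rmorph_sum.
apply: eq_bigr => s _; rewrite rmorph_prod; apply: eq_bigr => k _.
by rewrite /arc_weight; do 3?case: ifP.
Qed.

Lemma Epoly_gamma_sum n : (0 < n)%N ->
  Epoly n = gamma_sum n.+1 n zvar (xvar * yvar) (xvar + yvar).
Proof.
move=> n_gt0; rewrite Epoly_signed_permanent.
pose phi : {rmorphism {mpoly int[4]} -> {mpoly int[3]}} :=
  comp_mpoly [tuple xvar; yvar; zvar; 0].
have Dv : {in [:: X4 0; X4 1; X4 2; X4 3],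
    forall v : {mpoly int[4]}, xy_derivation v = 2 * (X4 0 * X4 1)}.
  by move=> v; rewrite !inE => /or4P[] /eqP ->; rewrite xy_derivationU.
have := signed_permanent_gamma xy_derivationM Dv n_gt0 (ltnSn n).
move/(congr1 phi); rewrite signed_permanent_rmorph gamma_sum_rmorph.
rewrite rmorphM !rmorphD /= !comp_mpolyXU /= addr0.
exact.
Qed.

(** * Coefficients of the powers of [z] *)

Lemma muni_widen (R : comNzRingType) n (i : 'I_n) :
  muni ('X_(widen_ord (leqnSn n) i) : {mpoly R[n.+1]}) = ('X_i)%:P.
Proof.
rewrite muniE msuppX big_seq1 mcoeffX eqxx scale1r mnm1E.
rewrite -val_eqE /= ltn_eqF // expr0 alg_polyC; congr ('X_[_])%:P.
by apply/mnmP=> j; rewrite mnmE !mnm1E.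
Qed.

Lemma muni_last (R : comNzRingType) n : muni ('X_ord_max : {mpoly R[n.+1]}) = 'X.
Proof.
rewrite muniE msuppX big_seq1 mcoeffX eqxx scale1r mnm1E eqxx expr1.
rewrite [X in 'X_[X]](_ : _ = 0%MM) ?mpolyX0 ?scale1r //.
by apply/mnmP=> j; rewrite mnmE mnm1E mnm0E -val_eqE /= gtn_eqF.
Qed.

(** [muni] is a ring morphism taking [x], [y] to constants and [z] to ['X], so row [i] of the
    expansion is a constant times ['X ^+ i]. *)
Lemma zcoef_gamma_sum n i :
  zcoef i (gamma_sum n.+1 n zvar (xvar * yvar) (xvar + yvar)) =
    \sum_(0 <= j < ((n - i)./2).+1) (gcoef n i%:Z j%:Z)%:~R *
      (('X_ord0 * 'X_ord_max) ^+ j * ('X_ord0 + 'X_ord_max) ^+ (n - i - 2 * j)).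
Proof.
have muni_x : muni xvar = ('X_ord0)%:P.
  by rewrite -muni_widen; congr (muni 'X__); apply: val_inj.
have muni_y : muni yvar = ('X_ord_max)%:P.
  by rewrite -muni_widen; congr (muni 'X__); apply: val_inj.
have muni_z : muni zvar = 'X.
  by rewrite -muni_last; congr (muni 'X__); apply: val_inj.
rewrite /zcoef gamma_sum_rmorph rmorphM rmorphD /= muni_x muni_y muni_z.
rewrite -polyCM -polyCD gamma_sum_rows coef_sum.
pose row k : {mpoly int[2]} := \sum_(0 <= j < ((n - k)./2).+1) (gcoef n k%:Z j%:Z)%:~R *
      (('X_ord0 * 'X_ord_max) ^+ j * ('X_ord0 + 'X_ord_max) ^+ (n - k - 2 * j)).
rewrite -/(row i) (eq_bigr (fun k => if k == i then row i else 0)) => [|k _].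
  rewrite -big_mkcond /=; have [iN|ni] := ltnP i n.+1.
    by rewrite big_nat1_eq iN.
  (* For [i > n] truncation leaves only [j = 0] in the row, with a zero coefficient. *)
  rewrite big_nat1_eq ltnNge ni /= /row big1 // => j _.
  by rewrite gcoef_outside ?mul0r //; lia.
have -> : \sum_(0 <= j < ((n - k)./2).+1) (gcoef n k j)%:~R *
   ((('X_ord0 * 'X_ord_max)%:P) ^+ j * (('X_ord0 + 'X_ord_max)%:P) ^+ (n - k - 2 * j))
   = (row k)%:P.
  rewrite rmorph_sum; apply: eq_bigr => j _.
  by rewrite !(rmorphM, rmorphXn, rmorphD, rmorph_int).
by rewrite coefMC coefXn eq_sym; case: eqVneq => [->|]; rewrite ?mul1r ?mul0r.
Qed.

Theorem theorem4 (n : nat) (hn : (1 <= n)%N) :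
  (forall i j : int, 0 <= gcoef n i j) /\
  Epoly n =
    \sum_(0 <= i < n.+1) zvar ^+ i *
      \sum_(0 <= j < ((n - i)./2).+1)
         gcoef n i%:Z j%:Z *:
           ((xvar * yvar) ^+ j * (xvar + yvar) ^+ (n - i - 2 * j)) /\
  partial_gamma_positive (Epoly n) /\
  (forall i : nat, gamma_positive (n - i) (dehomog (zcoef i (Epoly n)))).
Proof.
have E : Epoly n = \sum_(0 <= i < n.+1) zvar ^+ i *
      \sum_(0 <= j < ((n - i)./2).+1)
         gcoef n i%:Z j%:Z *:
           ((xvar * yvar) ^+ j * (xvar + yvar) ^+ (n - i - 2 * j)).
  rewrite Epoly_gamma_sum // gamma_sum_rows.
  apply: eq_bigr => i _; congr (_ * _); apply: eq_bigr => j _.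
  by rewrite mulrzl -scaler_int intz.
split; first exact: gcoef_ge0.
split; first exact: E.
split=> [|i].
  exists n, (fun i => (n - i)%N), (fun i j => gcoef n i%:Z j%:Z).
  by split=> [i j|]; first exact: gcoef_ge0.
exists (fun j => gcoef n i%:Z j%:Z); split=> [j|]; first exact: gcoef_ge0.
(* Setting [x = 'X], [y = 1] turns [x y] into ['X] and [x + y] into [1 + 'X]. *)
rewrite Epoly_gamma_sum // zcoef_gamma_sum /dehomog rmorph_sum.
apply: eq_bigr => j _; rewrite !rmorphM rmorph_int !rmorphXn rmorphM rmorphD.
rewrite /= !mmapX !mmap1U /= mulr1 [1 + _]addrC.
by rewrite mulrzl -scaler_int intz.
Qed.
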